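(* Let $\mathbb{F}$ be a field of characteristic $0$, let $a,b\in\mathbb{F}\setminus\{0\}$, and let $\mathbb{H}(a,b)$ be the generalized quaternion algebra over $\mathbb{F}$ with its standard involution $x\mapsto\overline{x}$. Let $\mathcal{D}_2$ be the ternary algebra on the vector space $\mathbb{H}(a,b)$ with product $[x,y,z]=(x\overline{y})z$. Then $\mathcal{D}_2$ is a simple ternary $D_{x,y}$-derivation algebra.
   Context: Cayley–Dickson doubling: given a unital algebra $\mathcal{U}$ over $\mathbb{F}$ with an involution $x\mapsto\overline{x}$ such that $x+\overline{x},\,x\overline{x}\in\mathbb{F}$ for all $x$, and given $c\in\mathbb{F}\setminus\{0\}$, the algebra $(\mathcal{U},c)$ is $\mathcal{U}\oplus\mathcal{U}$ with product $(x_1,x_2)(y_1,y_2)=(x_1y_1+c\,y_2\overline{x_2},\ \overline{x_1}y_2+y_1x_2)$ and involution $\overline{(x_1,x_2)}=(\overline{x_1},-x_2)$. Starting from $\mathbb{F}$ with the identity involution, $\mathbb{C}(a)=(\mathbb{F},a)$ and $\mathbb{H}(a,b)=(\mathbb{C}(a),b)$. A ternary $D_{x,y}$-derivation algebra is a ternary algebra (not assumed commutative) with trilinear product $[\cdot,\cdot,\cdot]$ such that for all pairs $x=(x_1,x_2)$, $y=(y_1,y_2)$ of elements the linear map $D_{x,y}(z)=[[z,x_1,x_2],y_1,y_2]-[[z,y_1,y_2],x_1,x_2]$ is a derivation: $D_{x,y}[z_1,z_2,z_3]=[D_{x,y}(z_1),z_2,z_3]+[z_1,D_{x,y}(z_2),z_3]+[z_1,z_2,D_{x,y}(z_3)]$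 for all $z_1,z_2,z_3$. An ideal of a ternary algebra $\mathcal{A}$ is a subspace $\mathcal{I}$ with $[\mathcal{I},\mathcal{A},\mathcal{A}],[\mathcal{A},\mathcal{I},\mathcal{A}],[\mathcal{A},\mathcal{A},\mathcal{I}]\subseteq\mathcal{I}$; $\mathcal{A}$ is simple if $[\mathcal{A},\mathcal{A},\mathcal{A}]\neq 0$ and its only ideals are $0$ and $\mathcal{A}$. *)

(* Defs.v *)
From HB Require Import structures.
From mathcomp Require Import all_boot all_order all_algebra.

Set Implicit Arguments.
Unset Strict Implicit.
Unset Printing Implicit Defensive.

Import GRing.Theory.
Local Open Scope ring_scope.

(* Neither associativity nor commutativity of the product is assumed; a
   condition "v lies in F" reads "v is a scalar multiple of the unit". *)
Record inv_algebra (F : fieldType) := InvAlgebra {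
  ia_space :> lmodType F;
  ia_mul : ia_space -> ia_space -> ia_space;
  ia_one : ia_space;
  ia_conj : ia_space -> ia_space;
  ia_mul_linearl : forall y, linear (fun x => ia_mul x y);
  ia_mul_linearr : forall x, linear (ia_mul x);
  ia_one_neq0 : ia_one != 0;
  ia_mul1x : forall x, ia_mul ia_one x = x;
  ia_mulx1 : forall x, ia_mul x ia_one = x;
  ia_conj_linear : linear ia_conj;
  ia_conjK : involutive ia_conj;
  ia_conjM : forall x y,
    ia_conj (ia_mul x y) = ia_mul (ia_conj y) (ia_conj x);
  ia_trace : forall x, exists k : F, x + ia_conj x = k *: ia_one;
  ia_norm : forall x, exists k : F, ia_mul x (ia_conj x) = k *: ia_one
}.

Section BaseField.
Variable F : fieldType.

Fact base_mul_linearl (y : F^o) : linear (fun x : F^o => x * y : F^o).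
Proof. by move=> k u v; rewrite mulrDl -scalerAl. Qed.

Fact base_mul_linearr (x : F^o) : linear (fun y : F^o => x * y : F^o).
Proof. by move=> k u v; rewrite mulrDr -scalerAr. Qed.

Fact base_conj_linear : linear (fun x : F^o => x).
Proof. by []. Qed.

(* The involution of F being the identity, its anti-multiplicativity is
   commutativity of the product. *)
Fact base_conjM (x y : F^o) : x * y = y * x.
Proof. exact: mulrC. Qed.

Fact base_scalar (x : F^o) : exists k : F, x = k *: (1 : F^o).
Proof. by exists x; rewrite /GRing.scale /= mulr1. Qed.

Definition base_algebra : inv_algebra F :=
  @InvAlgebra F F^o (fun x y => x * y) 1 (fun x => x)
    base_mul_linearl base_mul_linearr (oner_neq0 F) (@mul1r F) (@mulr1 F)
    base_conj_linear (fun x => erefl x) base_conjM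
    (fun x => base_scalar (x + x)) (fun x => base_scalar (x * x)).

End BaseField.

Section Doubling.
Variables (F : fieldType) (U : inv_algebra F) (c : F).
Local Notation mul := (@ia_mul F U).
Local Notation conj := (@ia_conj F U).
Local Notation one := (@ia_one F U).

Definition cd_mul (x y : U * U) : U * U :=
  (mul x.1 y.1 + c *: mul y.2 (conj x.2),
   mul (conj x.1) y.2 + mul y.1 x.2).

Definition cd_one : U * U := (one, 0).

Definition cd_conj (x : U * U) : U * U := (conj x.1, - x.2).

Let mulDZl y k u v : mul (k *: u + v) y = k *: mul u y + mul v y.
Proof. exact: ia_mul_linearl. Qed.
Let mulDZr x k u v : mul x (k *: u + v) = k *: mul x u + mul x v.
Proof. exact: ia_mul_linearr. Qed.
Let conjDZ k u v : conj (k *: u + v) = k *: conj u + conj v.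
Proof. exact: ia_conj_linear. Qed.
Let mulDl y u v : mul (u + v) y = mul u y + mul v y.
Proof. by have := mulDZl y 1 u v; rewrite !scale1r. Qed.
Let mulDr x u v : mul x (u + v) = mul x u + mul x v.
Proof. by have := mulDZr x 1 u v; rewrite !scale1r. Qed.
Let conjD u v : conj (u + v) = conj u + conj v.
Proof. by have := conjDZ 1 u v; rewrite !scale1r. Qed.
Let mul0x y : mul 0 y = 0.
Proof. by apply: (@addrI _ (mul 0 y)); rewrite -mulDl !addr0. Qed.
Let mulx0 x : mul x 0 = 0.
Proof. by apply: (@addrI _ (mul x 0)); rewrite -mulDr !addr0. Qed.
Let conj0 : conj 0 = 0.
Proof. by apply: (@addrI _ (conj 0)); rewrite -conjD !addr0. Qed.
Let conjZ k u : conj (k *: u) = k *: conj u.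
Proof. by have := conjDZ k u 0; rewrite conj0 !addr0. Qed.
Let conjN u : conj (- u) = - conj u.
Proof. by rewrite -scaleN1r conjZ scaleN1r. Qed.
Let mulNx u v : mul (- u) v = - mul u v.
Proof. by apply: (@addrI _ (mul u v)); rewrite -mulDl !subrr mul0x. Qed.
Let mulxN u v : mul u (- v) = - mul u v.
Proof. by apply: (@addrI _ (mul u v)); rewrite -mulDr !subrr mulx0. Qed.
Let conj1 : conj one = one.
Proof. by rewrite -[LHS](ia_mul1x) -{1}(ia_conjK one) -ia_conjM ia_mul1x ia_conjK. Qed.

Let pairE (u v : U * U) : u.1 = v.1 -> u.2 = v.2 -> u = v.
Proof. by case: u v => [? ?] [? ?] /= -> ->. Qed.

Fact cd_mul_linearl y : linear (fun x => cd_mul x y).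
Proof.
move=> k u v; apply: pairE; rewrite /= ?conjDZ ?mulDZl ?mulDZr.
  by rewrite !scalerDr !scalerA (mulrC c) addrACA.
by rewrite scalerDr addrACA.
Qed.

Fact cd_mul_linearr x : linear (cd_mul x).
Proof.
move=> k u v; apply: pairE; rewrite /= ?conjDZ ?mulDZl ?mulDZr.
  by rewrite !scalerDr !scalerA (mulrC c) addrACA.
by rewrite scalerDr addrACA.
Qed.

Fact cd_one_neq0 : cd_one != 0.
Proof. by apply/eqP => -[/eqP]; rewrite (negPf (ia_one_neq0 U)). Qed.

Fact cd_mul1x x : cd_mul cd_one x = x.
Proof.
by apply: pairE; rewrite /= ?conj0 ?conj1 ?mulx0 ?scaler0 ?ia_mul1x addr0.
Qed.

Fact cd_mulx1 x : cd_mul x cd_one = x.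
Proof.
apply: pairE; rewrite /= ?mul0x ?mulx0 ?scaler0 ?ia_mul1x ?ia_mulx1 ?addr0 //.
by rewrite add0r.
Qed.

Fact cd_conj_linear : linear cd_conj.
Proof.
by move=> k u v; apply: pairE; rewrite /= ?conjDZ // opprD scalerN.
Qed.

Fact cd_conjK : involutive cd_conj.
Proof. by move=> x; apply: pairE; rewrite /= ?ia_conjK ?opprK. Qed.

Fact cd_conjM x y : cd_conj (cd_mul x y) = cd_mul (cd_conj y) (cd_conj x).
Proof.
apply: pairE; rewrite /= ?ia_conjK.
  by rewrite conjD conjZ !ia_conjM ia_conjK conjN mulNx mulxN opprK.
by rewrite !mulxN opprD addrC.
Qed.

Fact cd_trace x : exists k : F, x + cd_conj x = k *: cd_one.
Proof.
have [k Ek] := ia_trace x.1.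
by exists k; apply: pairE; rewrite /= ?Ek // subrr scaler0.
Qed.

Fact cd_norm x : exists k : F, cd_mul x (cd_conj x) = k *: cd_one.
Proof.
have [k Ek] := ia_norm x.1; have [l El] := ia_norm x.2.
exists (k - c * l); apply: pairE; rewrite /=.
  by rewrite mulNx Ek El scalerN scalerA scalerBl.
by rewrite mulxN addNr scaler0.
Qed.

Definition cd_double : inv_algebra F :=
  InvAlgebra cd_mul_linearl cd_mul_linearr cd_one_neq0 cd_mul1x cd_mulx1
    cd_conj_linear cd_conjK cd_conjM cd_trace cd_norm.

End Doubling.

Definition gen_complex (F : fieldType) (a : F) : inv_algebra F :=
  cd_double (base_algebra F) a.

Definition gen_quaternion (F : fieldType) (a b : F) : inv_algebra F :=
  cd_double (gen_complex a) b.

Section Ternary.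
Variables (F : fieldType) (A : lmodType F) (t : A -> A -> A -> A).

Definition trilinear : Prop :=
  [/\ forall y z, linear (fun x => t x y z),
      forall x z, linear (fun y => t x y z)
    & forall x y, linear (fun z => t x y z)].

Definition ternary_derivation (D : A -> A) : Prop :=
  linear D /\
  forall z1 z2 z3,
    D (t z1 z2 z3) = t (D z1) z2 z3 + t z1 (D z2) z3 + t z1 z2 (D z3).

Definition Dxy (x y : A * A) (z : A) : A :=
  t (t z x.1 x.2) y.1 y.2 - t (t z y.1 y.2) x.1 x.2.

Definition Dxy_derivation_algebra : Prop :=
  trilinear /\ forall x y : A * A, ternary_derivation (Dxy x y).

(* Prop-valued, so that arbitrary subspaces, not only decidable ones, are
   considered. *)
Definition subspace (I : A -> Prop) : Prop :=
  I 0 /\ forall (k : F) u v, I u -> I v -> I (k *: u + v).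

Definition ternary_ideal (I : A -> Prop) : Prop :=
  [/\ subspace I,
      forall x y z, I x -> I (t x y z),
      forall x y z, I y -> I (t x y z)
    & forall x y z, I z -> I (t x y z)].

Definition ternary_simple : Prop :=
  (exists x y z, t x y z <> 0) /\
  forall I : A -> Prop, ternary_ideal I ->
    (forall x, I x <-> x = 0) \/ (forall x, I x).

End Ternary.

Definition D2_prod (F : fieldType) (a b : F) (x y z : gen_quaternion a b) :
    gen_quaternion a b :=
  ia_mul (ia_mul x (ia_conj y)) z.

(* Main.v *)
Require Import Defs.
From HB Require Import structures.
From mathcomp Require Import all_boot all_order all_algebra.
From mathcomp Require Import ring.
From Stdlib Require Import Classical_Prop.

Set Implicit Arguments.
Unset Strict Implicit.
Unset Printing Implicit Defensive.

Import GRing.Theory.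
Local Open Scope ring_scope.

(** Write [c*] for the conjugate of [c].  The first half of the theorem holds
    in every associative algebra with a scalar involution: with
    [p = x_1* x_2] and [q = y_1* y_2], associativity turns [D_{x,y}] into right
    multiplication by the commutator [c = pq - qp].  Since [p + p*] and
    [q + q*] are scalars, hence central, [c] is skew: [c* = - c]
    ([conj_commutator]).  Therefore, in
    [(z_1 c) z_2* z_3 + z_1 (z_2 c)* z_3 + z_1 z_2* (z_3 c)],
    where [(z_2 c)* = - c z_2*], the first two terms cancel and the third is
    [(z_1 z_2* z_3) c] ([conj_triple_Dxy_derivation]).

    For simplicity, putting the unit in the middle slot shows that a ternary
    ideal is a two-sided ideal of the quaternion algebra.  Conjugation by [i],
    [j] and [k] fixes the real part and changes the sign of two of the three
    imaginary coordinates, so that summing a quaternion and its three conjugates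
    leaves four times its real part ([quat_sum_conjugates]).  A nonzero element
    of the ideal has, after right multiplication by one of [1], [i], [j], [k], a
    nonzero real part ([quat_re_nondegenerate]); as [4] is invertible, the ideal
    contains the unit. *)

Section ScalarInvolution.
Variables (F : fieldType) (U : inv_algebra F).
Local Notation mul := (@ia_mul F U).
Local Notation conj := (@ia_conj F U).
Local Notation one := (@ia_one F U).

Lemma ia_mulBl (y u v : U) : mul (u - v) y = mul u y - mul v y.
Proof. by rewrite ![_ - _]addrC -!scaleN1r ia_mul_linearl. Qed.

Lemma ia_mulBr (x u v : U) : mul x (u - v) = mul x u - mul x v.
Proof. by rewrite ![_ - _]addrC -!scaleN1r ia_mul_linearr. Qed.

Lemma ia_conjB (u v : U) : conj (u - v) = conj u - conj v.
Proof. by rewrite ![_ - _]addrC -!scaleN1r ia_conj_linear. Qed.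

Lemma ia_mul0x (y : U) : mul 0 y = 0.
Proof. by rewrite -(subrr (0 : U)) ia_mulBl !subrr. Qed.

Lemma ia_mulx0 (x : U) : mul x 0 = 0.
Proof. by rewrite -(subrr (0 : U)) ia_mulBr !subrr. Qed.

Lemma ia_conj0 : conj 0 = 0.
Proof. by rewrite -(subrr (0 : U)) ia_conjB !subrr. Qed.

Lemma ia_mulNx (u v : U) : mul (- u) v = - mul u v.
Proof. by rewrite -[- u]add0r ia_mulBl ia_mul0x add0r. Qed.

Lemma ia_mulxN (u v : U) : mul u (- v) = - mul u v.
Proof. by rewrite -[- v]add0r ia_mulBr ia_mulx0 add0r. Qed.

Lemma ia_conj1 : conj one = one.
Proof.
by rewrite -[LHS]ia_mul1x -{1}(ia_conjK one) -ia_conjM ia_mul1x ia_conjK.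
Qed.

Lemma ia_mulZ1l (k : F) (x : U) : mul (k *: one) x = k *: x.
Proof. by rewrite -[k *: one]addr0 ia_mul_linearl ia_mul1x ia_mul0x addr0. Qed.

Lemma ia_mulZ1r (k : F) (x : U) : mul x (k *: one) = k *: x.
Proof. by rewrite -[k *: one]addr0 ia_mul_linearr ia_mulx1 ia_mulx0 addr0. Qed.

(** A commutator does not see scalars, and modulo scalars conjugation is
    negation. *)
Lemma conj_commutator (p q : U) :
  conj (mul p q - mul q p) = - (mul p q - mul q p).
Proof.
have [s Es] := ia_trace p; have [t Et] := ia_trace q.
have Ep : conj p = s *: one - p by rewrite -Es addrAC subrr add0r.
have Eq : conj q = t *: one - q by rewrite -Et addrAC subrr add0r.
have cancel (x y z : U) : x - y - (x - z) = z - y.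
  by rewrite opprB addrC subrKA.
rewrite ia_conjB !ia_conjM Ep ia_mulBr ia_mulBl ia_mulZ1l ia_mulZ1r cancel.
by rewrite Eq ia_mulBr ia_mulBl ia_mulZ1l ia_mulZ1r cancel opprB.
Qed.

Definition conj_triple (x y z : U) : U := mul (mul x (conj y)) z.

Lemma conj_triple_trilinear : trilinear conj_triple.
Proof.
split=> [y z k u v|x z k u v|x y k u v]; rewrite /conj_triple.
- by rewrite !ia_mul_linearl.
- by rewrite ia_conj_linear ia_mul_linearr ia_mul_linearl.
- by rewrite ia_mul_linearr.
Qed.

Hypothesis mulA : associative mul.

(** Right multiplication by [c] is a derivation as soon as [c] is skew, and
    [D_{x,y}] is right multiplication by a commutator. *)
Lemma conj_triple_Dxy_derivation : Dxy_derivation_algebra conj_triple.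
Proof.
split=> [|x y]; first exact: conj_triple_trilinear.
set p := mul (conj x.1) x.2; set q := mul (conj y.1) y.2.
pose c := mul p q - mul q p.
have DE z : Dxy conj_triple x y z = mul z c.
  by rewrite /Dxy /conj_triple /c ia_mulBr /p /q !mulA.
split=> [k u v|z1 z2 z3]; first by rewrite !DE ia_mul_linearl.
rewrite !DE /conj_triple ia_conjM conj_commutator -/c.
by rewrite ia_mulNx ia_mulxN ia_mulNx !mulA subrr add0r.
Qed.

Variable I : U -> Prop.
Hypothesis idealI : ternary_ideal conj_triple I.

Lemma conj_triple_ideall x y : I y -> I (mul x y).
Proof.
case: idealI => _ _ _ IR /(IR x one).
by rewrite /conj_triple ia_conj1 ia_mulx1.
Qed.

Lemma conj_triple_idealr x y : I x -> I (mul x y).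
Proof.
case: idealI => _ IL _ _ /(IL x one y).
by rewrite /conj_triple ia_conj1 ia_mulx1.
Qed.

End ScalarInvolution.

Section Quaternions.
Variables (F : fieldType) (a b : F).
Local Notation H := (gen_quaternion a b).
Local Notation mul := (@ia_mul F H).
Local Notation one := (@ia_one F H).

Definition quat (x0 x1 x2 x3 : F) : H := ((x0, x1), (x2, x3)).
Definition quat_re (x : H) : F := x.1.1.
Definition quat_i : H := quat 0 1 0 0.
Definition quat_j : H := quat 0 0 1 0.
Definition quat_k : H := quat 0 0 0 1.

Lemma quat_eq (x0 x1 x2 x3 y0 y1 y2 y3 : F) :
  x0 = y0 -> x1 = y1 -> x2 = y2 -> x3 = y3 ->
  quat x0 x1 x2 x3 = quat y0 y1 y2 y3.
Proof. by move=> -> -> -> ->. Qed.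

(** With this doubling [i j] is [- k], not [k], which explains the signs of the
    terms mixing two imaginary units. *)
Lemma quat_mulE (x0 x1 x2 x3 y0 y1 y2 y3 : F) :
  mul (quat x0 x1 x2 x3) (quat y0 y1 y2 y3) =
  quat (x0 * y0 + a * x1 * y1 + b * x2 * y2 - a * b * x3 * y3)
       (x0 * y1 + x1 * y0 + b * x2 * y3 - b * x3 * y2)
       (x0 * y2 + x2 * y0 - a * x1 * y3 + a * x3 * y1)
       (x0 * y3 + x3 * y0 - x1 * y2 + x2 * y1).
Proof. by apply: quat_eq; rewrite /= /GRing.scale /=; ring. Qed.

Lemma quat_scaleE (k x0 x1 x2 x3 : F) :
  k *: quat x0 x1 x2 x3 = quat (k * x0) (k * x1) (k * x2) (k * x3).
Proof. by []. Qed.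

Lemma quat_addE (x0 x1 x2 x3 y0 y1 y2 y3 : F) :
  quat x0 x1 x2 x3 + quat y0 y1 y2 y3 =
  quat (x0 + y0) (x1 + y1) (x2 + y2) (x3 + y3).
Proof. by []. Qed.

Lemma quat_mulA : associative mul.
Proof.
move=> [[x0 x1] [x2 x3]] [[y0 y1] [y2 y3]] [[z0 z1] [z2 z3]].
rewrite -!/(quat _ _ _ _) !quat_mulE.
by apply: quat_eq; ring.
Qed.

Hypotheses (a_neq0 : a != 0) (b_neq0 : b != 0).

(** The coefficients are the inverses of [i^2 = a], [j^2 = b] and
    [k^2 = - ab], so the last three terms are the conjugates of [x] by [i],
    [j] and [k]. *)
Lemma quat_sum_conjugates (x : H) :
  x + (a^-1 *: mul (mul quat_i x) quat_i
       + (b^-1 *: mul (mul quat_j x) quat_j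
          + (- (a * b)^-1) *: mul (mul quat_k x) quat_k))
  = (4%:R * quat_re x) *: one.
Proof.
case: x => [[x0 x1] [x2 x3]]; rewrite -/(quat x0 x1 x2 x3).
rewrite /quat_i /quat_j /quat_k !(quat_mulE _ _ _ _ x0) !quat_mulE.
rewrite !quat_scaleE !quat_addE.
by apply: quat_eq; rewrite /quat_re /=; field; rewrite a_neq0 b_neq0.
Qed.

(** The real parts of [x i], [x j] and [x k] are [a x_1], [b x_2] and
    [- ab x_3]. *)
Lemma quat_re_nondegenerate (x : H) :
  x != 0 -> exists y : H, quat_re (mul x y) != 0.
Proof.
case: x => [[x0 x1] [x2 x3]]; rewrite -/(quat x0 x1 x2 x3) => x_neq0.
have [x0_0|x0_neq0] := eqVneq x0 0; last first.
  by exists one; rewrite ia_mulx1.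
have [x1_0|x1_neq0] := eqVneq x1 0; last first.
  exists quat_i; rewrite quat_mulE /quat_re /= x0_0.
  by rewrite !(mul0r, mulr0, mulr1, add0r, addr0, subr0) mulf_neq0.
have [x2_0|x2_neq0] := eqVneq x2 0; last first.
  exists quat_j; rewrite quat_mulE /quat_re /= x0_0.
  by rewrite !(mul0r, mulr0, mulr1, add0r, addr0, subr0) mulf_neq0.
have [x3_0|x3_neq0] := eqVneq x3 0; last first.
  exists quat_k; rewrite quat_mulE /quat_re /= x0_0.
  rewrite !(mul0r, mulr0, mulr1, add0r, addr0) oppr_eq0.
  by rewrite !mulf_neq0.
by case/eqP: x_neq0; rewrite x0_0 x1_0 x2_0 x3_0.
Qed.

Hypothesis four_neq0 : 4%:R != 0 :> F.

Lemma quat_ideal_one (I : H -> Prop) (x : H) :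
  ternary_ideal (@conj_triple F H) I -> I x -> x != 0 -> I one.
Proof.
move=> idealI Ix /quat_re_nondegenerate[y re_neq0].
have [[I0 IDZ] _ _ _] := idealI.
have IZ k u : I u -> I (k *: u) by move=> Iu; rewrite -[_ *: _]addr0; apply: IDZ.
have ID u v : I u -> I v -> I (u + v).
  by move=> Iu Iv; rewrite -[u]scale1r; apply: IDZ.
have Iconj k e : I (k *: mul (mul e (mul x y)) e).
  apply/IZ/(conj_triple_idealr idealI)/(conj_triple_ideall idealI).
  exact: (conj_triple_idealr idealI).
have := ID _ _ (conj_triple_idealr idealI y Ix)
  (ID _ _ (Iconj a^-1 quat_i)
    (ID _ _ (Iconj b^-1 quat_j) (Iconj (- (a * b)^-1) quat_k))).
rewrite quat_sum_conjugates => /(IZ (4%:R * quat_re (mul x y))^-1).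
by rewrite scalerA mulVf ?scale1r // mulf_neq0.
Qed.

Lemma quat_conj_triple_simple : ternary_simple (@conj_triple F H).
Proof.
split=> [|I idealI].
  exists one, one, one; rewrite /conj_triple ia_conj1 !ia_mul1x.
  by apply/eqP/ia_one_neq0.
have [[I0 _] _ _ _] := idealI.
(* [I] is an arbitrary predicate, so that excluded middle is needed to tell
   whether it has a nonzero element. *)
have [[x [Ix x_neq0]]|noI] := classic (exists x, I x /\ x != 0); [right|left].
  move=> y; rewrite -[y](@ia_mul1x F H); apply: (conj_triple_idealr idealI).
  exact: quat_ideal_one Ix x_neq0.
move=> x; split=> [Ix|-> //].
by apply/eqP/negPn/negP => x_neq0; case: noI; exists x.
Qed.

End Quaternions.

Theorem theorem15 (F : fieldType) (charF0 : [pchar F] =i pred0)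
    (a b : F) (a_neq0 : a != 0) (b_neq0 : b != 0) :
  Dxy_derivation_algebra (@D2_prod F a b) /\ ternary_simple (@D2_prod F a b).
Proof.
split; first exact: conj_triple_Dxy_derivation (@quat_mulA F a b).
apply: quat_conj_triple_simple => //.
by move/pcharf0P: charF0 => ->.
Qed.
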